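(* Let $G$ be an even-linked graph of order $n$, let $C$ and $C'$ be the unique odd cycles of $G$, and let $X$ be the set of vertices in $V(C)\cup V(C')$ having degree $2$ in $G$. Let $(A,B)$ be the bipartition of the (connected bipartite) graph $G-X$ with $|A|=|B|+1$. Let $G_0,\dots,G_p=G$ be an ear-pendant decomposition witnessing that $G$ is even-linked, let $P$ be the path connecting the two odd cycles in $G_1$, and let $x,y$ be the end-points of $P$. Then $$\mathrm{corona}(G)=\left(V(C)\cup V(C')\cup B\right)\setminus\{x,y\}=V(G)\setminus A,$$ and, in particular, $$|\mathrm{corona}(G)|=\frac{n+|V(C)\cup V(C')|-3}{2}.$$
   Context: All graphs are finite, simple and undirected. $\mathrm{corona}(G)$ is the union of all maximum independent sets of $G$. A graph $G$ is $2$-bicritical if $|N(S)|>|S|$ for every nonempty independent set $S\subseteq V(G)$, where $N(S)=\bigcup_{v\in S}N(v)$. Let $H$ be a subgraph of $G$. An ear with respect to $H$ is an odd-length path whose endpoints lie in $H$ and whose internal vertices are distinct and lie outside $H$. A pendant with respect to $H$ is an odd cycle $D$, vertex-disjoint from $H$, together with a simple path of positive length with one end in $D$ and the other in $H$, all of whose other vertices lie outside both $H$ and $D$. A connected $2$-bicritical graph $G$ with exactly two odd cycles (counted as subgraphs) is an even-linked graph if there is a sequence (ear-pendant decomposition) $G_0,G_1,\dots,G_p=G$ such that $G_0$ is an odd cycle, $G_1$ is obtained from $G_0$ by adding a pendant, $G_i$ is obtained from $G_{i-1}$ by adding an ear for $i=2,\dots,p$, and the path of $G_1$ that connects its two odd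 cycles has even length. It is known that for such $G$, with $C,C',X$ as in the claim, $G-X$ is connected and bipartite with a bipartition $(A,B)$ satisfying $|A|=|B|+1$. *)

(* Defs.v *)
From mathcomp Require Import all_boot all_order all_algebra.

Set Implicit Arguments.
Unset Strict Implicit.
Unset Printing Implicit Defensive.

(* A finite simple graph with vertex set [T] is a symmetric irreflexive
   relation [e : rel T]; both properties are hypotheses where they are used.
   Edges of subgraphs are two-element vertex sets. *)

Section Graphs.

Variables (T : finType) (e : rel T).

Implicit Types (S U A B : {set T}) (s q : seq T) (x y v : T).

Definition nbh v : {set T} := [set w | e v w].

Definition nbhs_set S : {set T} := \bigcup_(v in S) nbh v.

Definition degree v : nat := #|nbh v|.

Definition independent S : bool := [forall u in S, forall v in S, ~~ e u v].

Definition max_independent S : bool :=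
  independent S && [forall U : {set T}, independent U ==> (#|U| <= #|S|)].

Definition corona : {set T} := \bigcup_(S | max_independent S) S.

Definition two_bicritical : Prop :=
  forall S, S != set0 -> independent S -> #|S| < #|nbhs_set S|.

Definition connected_graph : Prop := forall u v, connect e u v.

(* [(A, B)] is a bipartition of the subgraph induced by [U]. *)
Definition bipartition U A B : Prop :=
  [/\ A :|: B = U, [disjoint A & B], independent A & independent B].

Record subgraph := Subgraph {
  sg_verts : {set T};
  sg_edges : {set {set T}} }.

Implicit Types H D K : subgraph.

Definition whole : subgraph :=
  Subgraph [set: T] [set [set uv.1; uv.2] | uv : T * T & e uv.1 uv.2].

Definition sg_union H K : subgraph :=
  Subgraph (sg_verts H :|: sg_verts K) (sg_edges H :|: sg_edges K).

Definition path_graph s : subgraph :=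
  Subgraph [set:: s] [set:: [seq [set uv.1; uv.2] | uv <- zip s (behead s)]].

Definition cycle_graph s : subgraph :=
  Subgraph [set:: s] [set:: [seq [set u; next s u] | u <- s]].

(* Cycles are counted as subgraphs: different traversals of a cycle give the
   same [K]. *)
Definition odd_cycle K : Prop :=
  exists s, [/\ 2 < size s, odd (size s), uniq s, cycle e s
              & K = cycle_graph s].

Definition exactly_two_odd_cycles K1 K2 : Prop :=
  K1 <> K2 /\ forall K, odd_cycle K <-> (K = K1 \/ K = K2).

(* Ears and pendant paths run through the vertices [x :: rcons q y]: [x] and
   [y] are the endpoints, [q] lists the internal vertices, and the length is
   [(size q).+1].  As only the internal vertices of an ear are required to be
   distinct, [x = y] is allowed; in an even-linked graph such an ear cannot
   occur, since it would be a third odd cycle. *)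
Definition ear H x q y : Prop :=
  [/\ path e x (rcons q y), odd (size q).+1,
      x \in sg_verts H, y \in sg_verts H
    & uniq q && all [predC sg_verts H] q].

Definition pendant H D x q y : Prop :=
  [/\ odd_cycle D, [disjoint sg_verts D & sg_verts H],
      path e x (rcons q y) && uniq (x :: rcons q y),
      x \in sg_verts H /\ y \in sg_verts D
    & all [predC sg_verts H :|: sg_verts D] q].

(* [G_0, ..., G_p] is an ear-pendant decomposition in which [G_1] is obtained
   by adding the pendant made of the odd cycle [D] and the even-length path
   [x :: rcons q y].  The values [G_ i] with [i > p] are irrelevant. *)
Definition even_linked_decomposition (p : nat) (G_ : nat -> subgraph)
    D x q y : Prop :=
  [/\ odd_cycle (G_ 0),
      pendant (G_ 0) D x q y
        /\ G_ 1 = sg_union (sg_union (G_ 0) D) (path_graph (x :: rcons q y)),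
      ~~ odd (size q).+1,
      forall i, 2 <= i <= p -> exists u r v,
        ear (G_ i.-1) u r v
          /\ G_ i = sg_union (G_ i.-1) (path_graph (u :: rcons r v))
    & 1 <= p /\ G_ p = whole].

Definition even_linked : Prop :=
  [/\ connected_graph, two_bicritical,
      exists K1 K2, exactly_two_odd_cycles K1 K2
    & exists p G_ D x q y, even_linked_decomposition p G_ D x q y].

End Graphs.

(* Main.v *)
(** Let [s] and [s'] be the odd cycles, joined by the even path from [x] to [y].
    A path outside [s] or a chord between two vertices of [s] would give a third
    odd cycle, so a component [K] of [G - s] is adjacent to at most one
    vertex of [s].  If [K] hangs at a vertex [v != x], then it avoids [s'], so
    [v |: K] is bipartite, and 2-bicriticality applied to its two classes is
    contradictory.  Hence [X] is the union of the two cycles minus [x] and [y].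
    The path being even, [x] and [y] lie on the same side, and this side is
    [A], for otherwise [N(A)] would be contained in [B].  Finally, let [I] be
    independent.  It meets each cycle in at most half of its vertices, and
    2-bicriticality applied to [I :&: (A :\: [set x; y])], whose neighbours lie
    in [B :\: I], bounds the rest of [I] by [#|B|], strictly if [I] meets [A].
    The bound is attained by [B] together with either alternating half of
    [s - x] and of [s' - y], and these sets cover the complement of [A]. *)
Require Import Defs.
From mathcomp Require Import all_boot all_order all_algebra.
From mathcomp Require Import zify lra.

Set Implicit Arguments.
Unset Strict Implicit.
Unset Printing Implicit Defensive.

Import GRing.Theory.

(** * A further odd cycle obtained from an odd cycle and an ear *)

Section OddCycles.

Variables (T : finType) (e : rel T).
Hypothesis e_sym : symmetric e.

Implicit Types (s c p r : seq T) (u v w x y z : T).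

(** Odd cycles are handled as traversals and compared through their vertex sets, so that no edge
    sets have to be carried along. *)
Definition odd_cycle_seq s :=
  [/\ 2 < size s, odd (size s), uniq s & cycle e s].

Lemma path_rev_sym v r u : path e v (rcons r u) -> path e u (rcons (rev r) v).
Proof.
have:= rev_path e v (rcons r u); rewrite last_rcons belast_rcons rev_cons => ->.
by rewrite (eq_path (e' := e)) // => a b /=; rewrite e_sym.
Qed.

(** The new cycle follows the arc [v, p1, u] and returns along [rev r]; its length is
    [size p1 + size r + 2]. The condition on [p2] keeps [r] from being the edge of the given cycle
    that closes it from [u] to [v]. *)
Lemma arc_odd_cycle v p1 u p2 r :
    uniq (v :: p1 ++ u :: p2) -> cycle e (v :: p1 ++ u :: p2) ->
    uniq r -> {in r, forall z, z \notin v :: p1 ++ u :: p2} ->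
    path e v (rcons r u) -> (r = [::] -> p2 != [::]) ->
    odd (size p1 + size r) ->
  exists c, [/\ odd_cycle_seq c, v \in c
    & [set:: c] != [set:: v :: p1 ++ u :: p2]].
Proof.
move=> s_uniq s_cyc r_uniq r_out r_path chord odd_c.
exists (v :: p1 ++ u :: rev r); split; last 1 first.
(* The vertex sets differ at the first vertex of [r] or, when [r] is empty, at the first vertex of
   [p2]. *)
- apply/eqP => /setP eq_cs.
  case: r => [|z r] in r_uniq r_out r_path chord odd_c eq_cs.
    case: p2 => [|z p2] in s_uniq s_cyc r_out chord eq_cs; first by have := chord erefl.
    have := eq_cs z; rewrite !inE !mem_cat !inE eqxx !orbT.
    move: s_uniq; rewrite /= cat_uniq mem_cat !inE /= !inE !negb_or.
    case/and3P=> /and4P[_ _ vz _] _ /and3P[/and3P[_ zp _] /andP[uz _] _].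
    by rewrite [z == v]eq_sym (negPf vz) (negPf zp) eq_sym (negPf uz).
  have := eq_cs z; rewrite [in RHS]inE (negPf (r_out z _)) ?mem_head //.
  by rewrite inE inE mem_cat inE mem_rev mem_head !orbT.
- split.
  + by rewrite /= size_cat /= size_rev addnS; case: (size p1 + size r) odd_c.
  + by rewrite /= size_cat /= size_rev addnS /= negbK.
  + move: s_uniq r_uniq r_out; rewrite -!cat_cons -!cat_rcons !cat_uniq rev_uniq.
    case/and3P=> -> _ _ -> r_out; rewrite andbT /=; apply/hasPn => z.
    by rewrite mem_rev => /r_out; rewrite mem_cat negb_or => /andP[].
  + move: s_cyc; rewrite /cycle !rcons_cat !cat_path /= => /and3P[-> -> _].
    exact: path_rev_sym.
- exact: mem_head.
Qed.

(** As [s] is odd, its two arcs between [v] and [u] have lengths of different parity, so one of them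
    closes up with [r] to an odd cycle. That [c] meets [s] serves to tell it from an odd cycle
    disjoint from [s]. *)
Lemma ear_odd_cycle s v u r :
    odd_cycle_seq s -> v \in s -> u \in s -> v != u ->
    uniq r -> {in r, forall z, z \notin s} -> path e v (rcons r u) ->
    (r = [::] -> u != next s v /\ v != next s u) ->
  exists c, [/\ odd_cycle_seq c, (v \in c) || (u \in c)
    & [set:: c] != [set:: s]].
Proof.
move=> [_ s_odd s_uniq s_cyc] vs us vu r_uniq r_out r_path chord.
have [i s1 def_s] := rot_to vs.
have mem_s z : (z \in s) = (z \in v :: s1) by rewrite -def_s mem_rot.
have size_s : size s = size (v :: s1) by rewrite -def_s size_rot.
have {}chord : r = [::] -> u != next (v :: s1) v /\ v != next (v :: s1) u.
  by rewrite -def_s !next_rot.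
have {}s_uniq : uniq (v :: s1) by rewrite -def_s rot_uniq.
have {}s_cyc : cycle e (v :: s1) by rewrite -def_s rot_cycle.
have -> : [set:: s] = [set:: v :: s1] by apply/setP=> z; rewrite !inE mem_s inE.
have us1 : u \in s1 by move: us; rewrite mem_s inE eq_sym (negPf vu).
have {}r_out : {in r, forall z, z \notin v :: s1}.
  by move=> z /r_out; rewrite mem_s.
rewrite {}size_s in s_odd; move: chord s_odd s_uniq s_cyc r_out.
case/splitPr: us1 {def_s mem_s} => p1 p2 chord s_odd s_uniq s_cyc r_out.
have [odd_c|even_c] := boolP (odd (size p1 + size r)).
  have [|c [c_odd vc ne_cs]] := arc_odd_cycle s_uniq s_cyc r_uniq r_out r_path _ odd_c.
    move=> /chord[_]; apply: contraNneq => p2_nil; rewrite p2_nil in s_uniq *.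
    (* With [p2] empty, [u] is the last vertex, and its [next] is the default value of [nth], namely
       the head [v]. *)
    rewrite next_nth -cat_cons mem_cat mem_head orbT index_cat.
    move: s_uniq; rewrite -cat_cons cat_uniq /= orbF => /and3P[_ /negPf-> _].
    by rewrite eqxx addn0 nth_default // size_cat /= addn1.
  by exists c; rewrite vc.
(* For the other arc, the traversal is rotated to start at [u] and [r] is reversed. *)
have eq_rot : rot (size p1).+1 (v :: p1 ++ u :: p2) = u :: p2 ++ v :: p1.
  by rewrite -cat_cons -[(size p1).+1]/(size (v :: p1)) rot_size_cat.
have [|||z||||c [c_odd uc ne_cs]] := @arc_odd_cycle u p2 v p1 (rev r).
- by rewrite -eq_rot rot_uniq.
- by rewrite -eq_rot rot_cycle.
- by rewrite rev_uniq.
- by rewrite -eq_rot mem_rot mem_rev; apply: r_out.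
- exact: path_rev_sym.
- move=> r_nil; have /chord[+ _] : r = [::] by rewrite -[r]revK r_nil.
  by apply: contraNneq => ->; rewrite /= eqxx.
- by move: s_odd even_c; rewrite /= size_cat size_rev /= addnS /= !oddD; do 3!case: odd.
exists c; rewrite uc orbT; split=> //.
by apply: contraNneq ne_cs => ->; apply/eqP/setP=> z; rewrite -eq_rot !inE mem_rot inE.
Qed.

End OddCycles.

(** * Graphs whose only odd cycles are two disjoint ones *)

Section TwoOddCycles.

Variables (T : finType) (e : rel T).
Hypotheses (e_sym : symmetric e) (e_irr : irreflexive e).
Variables (s s' : seq T).
Hypotheses (s_odd : odd_cycle_seq e s) (s'_odd : odd_cycle_seq e s').
Hypothesis disj_s : forall z, z \in s -> z \notin s'.
Hypothesis only_s : forall c,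
  odd_cycle_seq e c -> [set:: c] = [set:: s] \/ [set:: c] = [set:: s'].

Implicit Types (u v w x y z : T) (r : seq T) (S A B K : {set T}).

(** Any ear other than an edge of [s] yields an odd cycle whose vertex set is not that of [s]; since
    it meets [s], it is not that of [s'] either. *)
Lemma no_ear v u r :
    v \in s -> u \in s -> v != u ->
    uniq r -> {in r, forall z, z \notin s} -> path e v (rcons r u) ->
  r = [::] /\ (u = next s v \/ v = next s u).
Proof.
move=> vs us vu r_uniq r_out r_path.
suff: ~~ ((r == [::]) ==> (u != next s v) && (v != next s u)).
  rewrite negb_imply negb_and !negbK => /andP[/eqP-> /orP[]/eqP]; by auto.
apply/negP => chord.
have [|c [c_odd + /eqP ne_cs]] := ear_odd_cycle e_sym s_odd vs us vu r_uniq r_out r_path.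
  by move=> r_nil; move: chord; rewrite r_nil eqxx => /andP[].
have [//|eq_cs'] := only_s c_odd.
have mem_c z : (z \in c) = (z \in s') by have /setP/(_ z) := eq_cs'; rewrite !inE.
by rewrite !mem_c (negPf (disj_s vs)) (negPf (disj_s us)).
Qed.

Lemma cycle_nbrs v w : v \in s -> w \in s -> e v w -> w = next s v \/ v = next s w.
Proof.
move=> vs ws evw; have vw : v != w by apply: contraTneq evw => ->; rewrite e_irr.
by case: (@no_ear v w [::] vs ws vw); rewrite //= evw.
Qed.

Lemma next_prev_neq v : v \in s -> next s v != prev s v.
Proof.
case: s_odd => s_gt2 _ s_uniq _ vs; have [i s1 def_s] := rot_to vs.
apply/eqP=> eq_np; have := next_prev s_uniq v.
have : uniq (v :: s1) by rewrite -def_s rot_uniq.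
have : 2 < size (v :: s1) by rewrite -def_s size_rot.
rewrite -eq_np -!(next_rot i s_uniq) def_s.
case: s1 {def_s} => [|a [|b s1]] //= _ /and3P[].
rewrite !inE !negb_or => /and3P[va vb _] _ _; rewrite !eqxx [a == v]eq_sym (negPf va).
by move=> eq_bv; rewrite eq_bv eqxx in vb.
Qed.

Lemma degree_gt2 v w : v \in s -> w \notin s -> e v w -> 2 < degree e v.
Proof.
move=> vs ws evw; have [_ _ _ s_cyc] := s_odd.
have [wn wp] : w != next s v /\ w != prev s v.
  by split; apply: contraNneq ws => ->; rewrite ?mem_next ?mem_prev.
apply: leq_trans (_ : #|[set next s v; prev s v; w]| <= _).
  by rewrite setUC cardsU1 cards2 next_prev_neq // !inE (negPf wn) (negPf wp).
apply/subset_leq_card/subsetP => a; rewrite !inE => /orP[/orP[]|]/eqP->//.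
  exact: next_cycle.
by rewrite e_sym; apply: prev_cycle.
Qed.

Lemma degree_cycle_eq2 v :
    v \in s -> (forall w, e v w -> w = next s v \/ v = next s w) ->
  degree e v = 2.
Proof.
move=> vs nbr_v; have [_ _ s_uniq s_cyc] := s_odd.
have -> : degree e v = #|[set next s v; prev s v]|; last by rewrite cards2 next_prev_neq.
apply: eq_card => w; rewrite !inE; apply/idP/orP => [/nbr_v[->|->]|[]/eqP->].
- by left.
- by right; rewrite prev_next.
- exact: next_cycle.
- by rewrite e_sym; apply: prev_cycle.
Qed.

Definition outside S : rel T := [rel u v | [&& e u v, u \notin S & v \notin S]].

Lemma outside_sym S : symmetric (outside S).
Proof. by move=> u v; rewrite /outside /= e_sym; congr (_ && _); apply: andbC. Qed.

Lemma outside_connect_notin S u v : u \notin S -> connect (outside S) u v -> v \notin S.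
Proof.
move=> uS /connectP[r]; elim/last_ind: r v => [|r a _] v /=; first by move=> _ ->.
by rewrite last_rcons rcons_path => /andP[_ /and3P[_ _ ?]] ->.
Qed.

Lemma path_outside S u r :
  path e u r -> {in u :: r, forall v, v \notin S} -> path (outside S) u r.
Proof.
move=> ur_path ur_out; apply: sub_in_path (_ : all (predC (mem S)) (u :: r)) ur_path.
  by move=> a b /= aS bS eab; apply/and3P.
by apply/allP=> v /ur_out.
Qed.

Lemma cycle_connect_outside S c u v :
    cycle e c -> {in c, forall z, z \notin S} -> u \in c -> v \in c ->
  connect (outside S) u v.
Proof.
move=> c_cyc c_out uc vc; have [i c1 def_c] := rot_to uc.
have mem_c z : (z \in c) = (z \in u :: c1) by rewrite -def_c mem_rot.
apply: (path_connect (p := rcons c1 u)).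
  apply: path_outside => [|z]; first by have := c_cyc; rewrite -(rot_cycle i) def_c.
  by rewrite -rcons_cons mem_rcons inE -mem_c => /predU1P[->|]; apply: c_out.
by rewrite -rcons_cons mem_rcons inE -mem_c vc orbT.
Qed.

(** A walk from [w] to [z] off [s], shortened to a simple path, would be the interior of an ear from
    [v] to [u]. Hence a component of the graph without [s] is attached to at most one vertex of
    [s]. *)
Lemma no_ear_outside v w z u :
    v \in s -> w \notin s -> e v w -> connect (outside [set:: s]) w z ->
    u \in s -> e z u -> u = v.
Proof.
move=> vs ws evw wz us ezu; apply/eqP/negPn/negP=> uv.
have [r [r_path r_uniq def_z]] : exists r,
    [/\ path (outside [set:: s]) w r, uniq (w :: r) & z = last w r].
  by case/connectP: wz => r /shortenP[r' ? ? _] ->; exists r'.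
suff [] : w :: r = [::] /\ (u = next s v \/ v = next s u) by [].
apply: no_ear => //; first by rewrite eq_sym.
  move=> a /(path_connect r_path)/outside_connect_notin.
  by rewrite !inE; apply.
rewrite /= evw rcons_path -def_z ezu andbT.
by apply: sub_path r_path => a b /= /andP[].
Qed.

(** Every edge switches sides, and the path has [(size r).+1] edges, an even number. *)
Lemma even_path_side S A B a r b :
    bipartition e S A B -> path e a (rcons r b) -> odd (size r) ->
    {subset a :: rcons r b <= S} -> (a \in A) = (b \in A).
Proof.
case=> [UAB disjAB indA indB] ar_path r_odd ar_S.
have side u v : u \in S -> v \in S -> e u v -> (v \in A) = (u \notin A).
  rewrite -UAB !inE => uS vS euv.
  have [uA|uA] := boolP (u \in A).
    by apply/negP => vA; have /forall_inP/(_ u uA)/forall_inP/(_ v vA)/negP := indA.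
  have uB : u \in B by rewrite (negPf uA) in uS.
  have [//|vA] := boolP (v \in A); rewrite (negPf vA) /= in vS.
  by have /forall_inP/(_ u uB)/forall_inP/(_ v vS)/negP := indB.
have side_last p u : path e u p -> {subset u :: p <= S} ->
    (last u p \in A) = (u \in A) (+) odd (size p).
  elim: p u => [|v p IHp] u /=; first by rewrite addbF.
  case/andP=> euv vp_path uvp_S; rewrite IHp // => [|z zp]; last first.
    by apply: uvp_S; rewrite inE zp orbT.
  rewrite (side u) ?uvp_S ?inE ?eqxx ?orbT //.
  by case: (u \in A) (odd _) => [] [].
by have := side_last _ _ ar_path ar_S; rewrite last_rcons size_rcons /= r_odd addbF.
Qed.

Lemma bipartitionC S A B : bipartition e S A B -> bipartition e S B A.
Proof. by case=> <- dAB iA iB; split; rewrite // 1?setUC // disjoint_sym. Qed.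

(** * Consequences of 2-bicriticality: only one vertex of each cycle has neighbours off the cycle *)

Hypothesis bicrit : two_bicritical e.
Variables (X A B : {set T}).
Hypothesis X_def : X = [set v in [set:: s] :|: [set:: s'] | degree e v == 2].
Hypothesis bip_AB : bipartition e (~: X) A B.

(* [N(K :&: S2)] is contained in [v |: K :&: S1], and [N(K :&: S1)] in [K :&: S2];
   2-bicriticality makes each of these two neighbourhoods strictly larger than
   the class it comes from. *)
Lemma hanging_bipartite_absurd S1 S2 v w K :
    bipartition e (~: X) S1 S2 -> v \in S1 -> v \notin K -> w \in K ->
    w \in S2 -> K \subset ~: X ->
    (forall z t, z \in K -> e z t -> t = v \/ t \in K) -> False.
Proof.
case=> US disjS indS1 indS2 vS1 vK wK wS2 subK nbhK.
have K2_0 : K :&: S2 != set0 by apply/set0Pn; exists w; rewrite inE wK.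
have lt_K21 : #|K :&: S2| < #|v |: K :&: S1|.
  have indK2 : independent e (K :&: S2).
    apply/forall_inP=> a /setIP[_ aS]; apply/forall_inP=> b /setIP[_ bS].
    by have /forall_inP/(_ a aS)/forall_inP/(_ b bS) := indS2.
  apply: leq_trans (bicrit K2_0 indK2) (subset_leq_card _).
  apply/bigcupsP => a /setIP[aK aS]; apply/subsetP => b; rewrite !inE => eab.
  have [->|bK] := nbhK a b aK eab; first by rewrite eqxx.
  have := subsetP subK b bK; rewrite -US inE bK => /orP[->|bS]; first by rewrite orbT.
  by have /forall_inP/(_ a aS)/forall_inP/(_ b bS)/negP := indS2.
(* Were this class empty, [lt_K21] would read [#|K :&: S2| < 1]. *)
have K1_0 : K :&: S1 != set0.
  apply/eqP => K1_0; move: lt_K21 K2_0; rewrite K1_0 setU0 cards1 ltnS leqn0 cards_eq0.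
  by move->.
have indK1 : independent e (K :&: S1).
  apply/forall_inP=> a /setIP[_ aS]; apply/forall_inP=> b /setIP[_ bS].
  by have /forall_inP/(_ a aS)/forall_inP/(_ b bS) := indS1.
have lt_K12 : #|K :&: S1| < #|K :&: S2|.
  apply: leq_trans (bicrit K1_0 indK1) (subset_leq_card _).
  apply/bigcupsP => a /setIP[aK aS]; apply/subsetP => b; rewrite !inE => eab.
  have eS1 c : c \in S1 -> e a c -> False.
    by move=> cS; have /forall_inP/(_ a aS)/forall_inP/(_ c cS)/negP := indS1.
  have [def_b|bK] := nbhK a b aK eab; first by case: (eS1 v) => //; rewrite -def_b.
  by have := subsetP subK b bK; rewrite -US inE bK => /orP[/eS1/(_ eab)|].
move: lt_K21; rewrite cardsU1 inE (negPf vK) /= add1n ltnS leqNgt.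
by rewrite lt_K12.
Qed.

(** Let [K] be the component of [w] off [s]. If [K] met [s'], it would contain [z] and be attached
    to [x] as well as to [v]. So [K] avoids both cycles and hence [X], while [v] escapes [X] by its
    degree; the edge from [v] to [w] puts them on opposite sides, and [K] hangs at [v]. *)
Lemma cycle_nbh_closed x z v w :
    x \in s -> z \notin s -> e z x ->
    {in s', forall d, connect (outside [set:: s]) d z} ->
    v \in s -> v != x -> e v w -> w \in s.
Proof.
move=> xs zs ezx conn_s' vs vx evw; apply/negPn/negP => ws.
pose K := [set t | connect (outside [set:: s]) w t].
have Ks a : a \in K -> a \notin s.
  by rewrite inE => /outside_connect_notin; rewrite !inE; apply.
have Ks' a : a \in K -> a \notin s'.
  rewrite inE => wa; apply/negP => /conn_s' az.
  have /eqP := no_ear_outside vs ws evw (connect_trans wa az) xs ezx.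
  by rewrite eq_sym (negPf vx).
have subK : K \subset ~: X.
  apply/subsetP=> a aK; rewrite X_def !inE.
  by rewrite (negPf (Ks a aK)) (negPf (Ks' a aK)).
have wK : w \in K by rewrite inE.
have vK : v \notin K by apply: contraL vs => /Ks.
have nbhK a b : a \in K -> e a b -> b = v \/ b \in K.
  move=> aK eab; have [bs|bs] := boolP (b \in s); [left|right].
    by apply: no_ear_outside evw _ bs eab; rewrite // inE in aK.
  move: aK (Ks a aK); rewrite !inE => wa as_; apply: connect_trans wa (connect1 _).
  by rewrite /outside /= !inE eab as_.
have vX : v \in ~: X.
  by rewrite X_def !inE vs /= gtn_eqF // (degree_gt2 vs ws).
have wX : w \in ~: X by apply: (subsetP subK).
have [UAB _ indA indB] := bip_AB.
have ind_vw S : v \in S -> w \in S -> independent e S -> False.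
  by move=> vS wS /forall_inP/(_ v vS)/forall_inP/(_ w wS)/negP.
move: vX wX; rewrite -UAB !inE => /orP[vA|vB] /orP[wA|wB].
- exact: ind_vw indA.
- exact: hanging_bipartite_absurd bip_AB vA vK wK wB subK nbhK.
- exact: hanging_bipartite_absurd (bipartitionC bip_AB) vB vK wK wA subK nbhK.
- exact: ind_vw indB.
Qed.

(** The path beyond [x], together with [s'], is connected off [s], which puts all of [s'] into the
    component of [z]. Neighbours on [s] itself are cycle neighbours because [s] has no chord. *)
Lemma linked_cycle_nbrs x z q y :
    x \in s -> y \in s' -> path e x (rcons (z :: q) y) ->
    {in z :: q, forall v, v \notin s} ->
  {in s, forall u, u != x -> forall w, e u w -> w = next s u \/ u = next s w}.
Proof.
move=> xs ys' /andP[exz zq_path] zq_out u us ux w euw.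
have [_ _ _ s'_cyc] := s'_odd.
have s'_out v : v \in s' -> v \notin [set:: s].
  by rewrite inE; apply: contraL => /disj_s.
apply: cycle_nbrs => //; apply: (cycle_nbh_closed xs (zq_out z _) _ _ us ux euw).
- exact: mem_head.
- by rewrite e_sym.
move=> d ds'; apply: connect_trans (cycle_connect_outside s'_cyc s'_out ds' ys') _.
rewrite (sym_connect_sym (outside_sym _)); apply: (path_connect (p := rcons q y)).
  apply: path_outside => // v; rewrite -rcons_cons mem_rcons inE.
  by case/predU1P=> [->|/zq_out]; [apply: s'_out | rewrite inE].
by rewrite -rcons_cons mem_rcons mem_head.
Qed.

End TwoOddCycles.

(** * Independent sets on an odd cycle *)

Section IndependentSets.

Variables (T : finType) (e : rel T).
Hypotheses (e_sym : symmetric e) (e_irr : irreflexive e).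

Implicit Types (u v w x y z : T) (s : seq T) (S I J A B : {set T}).

Lemma independentS I J : J \subset I -> independent e I -> independent e J.
Proof.
move=> /subsetP sJI indI; apply/forall_inP=> a /sJI aI; apply/forall_inP=> b /sJI bI.
by have /forall_inP/(_ a aI)/forall_inP/(_ b bI) := indI.
Qed.

Lemma independent_edge I u v : independent e I -> u \in I -> e u v -> v \notin I.
Proof.
move=> indI uI; apply: contraL => vI.
by have /forall_inP/(_ u uI)/forall_inP/(_ v vI) := indI.
Qed.

Lemma independentU I J :
    independent e I -> independent e J ->
    (forall u v, u \in I -> v \in J -> ~~ e u v) -> independent e (I :|: J).
Proof.
move=> indI indJ IJ; apply/forall_inP=> u uIJ; apply/forall_inP=> v vIJ.
apply/negP=> euv; case/setUP: uIJ => [uI|uJ]; case/setUP: vIJ => [vI|vJ].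
- by have := independent_edge indI uI euv; rewrite vI.
- by have := IJ u v uI vJ; rewrite euv.
- by have := IJ v u vI uJ; rewrite e_sym euv.
- by have := independent_edge indJ uJ euv; rewrite vJ.
Qed.

(** The successor map [next s] injects [I :&: [set:: s]] into [[set:: s] :\: I]. *)
Lemma independent_odd_cycle s I :
  odd_cycle_seq e s -> independent e I -> #|I :&: [set:: s]| <= (size s)./2.
Proof.
case=> _ s_odd s_uniq s_cyc indI.
have card_s : #|[set:: s]| = size s by rewrite cardsE; apply/card_uniqP.
have : #|I :&: [set:: s]| <= #|[set:: s] :\: I|.
  rewrite -(card_imset _ (can_inj (prev_next s_uniq))).
  apply/subset_leq_card/subsetP=> _ /imsetP[z /setIP[zI zs] ->].
  rewrite !inE in zs *; rewrite mem_next zs andbT.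
  by apply: independent_edge indI zI _; apply: next_cycle.
have := cardsID I [set:: s]; rewrite card_s setIC => <-; lia.
Qed.

(** Removing [x] leaves a path with an even number of vertices; [J] is the alternating half of it
    that contains [v]. *)
Lemma half_cycle_independent s x v :
    odd_cycle_seq e s -> x \in s ->
    {in s, forall u, u != x -> forall w, e u w -> w = next s u \/ u = next s w} ->
    v \in s -> v != x ->
  exists J, [/\ J \subset [set:: s] :\ x, v \in J, independent e J
    & #|J| = (size s)./2].
Proof.
move=> s_oddc xs nbr_s vs vx; have [s_gt2 s_odd s_uniq s_cyc] := s_oddc.
have [i t def_s] := rot_to xs.
have mem_s z : (z \in s) = (z \in x :: t) by rewrite -def_s mem_rot.
have size_s : size s = (size t).+1 by rewrite -(size_rot i) def_s.
have xt_uniq : uniq (x :: t) by rewrite -def_s rot_uniq.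
have next_index z : z \in t -> next s z != x ->
    index (next s z) t = (index z t).+1.
  move=> zt; rewrite -(next_rot i s_uniq) def_s next_nth inE zt orbT /=.
  have /andP[xt t_uniq] := xt_uniq.
  rewrite ifN; last by apply: contraNneq xt => ->.
  case: (ltnP (index z t).+1 (size t)) => [lt_zt _|le_tz].
    by rewrite index_uniq.
  by rewrite nth_default ?eqxx.
(* The halves are the parity classes of positions in [t], the traversal of the cycle after [x]. An
   edge within [s - x] joins consecutive positions, so its ends have different parity. *)
pose J b := [set z in s | (z != x) && (odd (index z t) == b)].
have indJ b : independent e (J b).
  apply/forall_inP=> u; rewrite inE => /and3P[us ux /eqP u_b].
  apply/forall_inP=> w; rewrite inE => /and3P[ws wx /eqP w_b].
  have in_t z : z \in s -> z != x -> z \in t.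
    by rewrite mem_s inE => /predU1P[->|//]; rewrite eqxx.
  apply/negP=> euw; have [def_w|def_u] := nbr_s u us ux w euw.
    move: w_b; rewrite def_w next_index ?in_t -?def_w //= u_b.
    by case: (b).
  move: u_b; rewrite def_u next_index ?in_t -?def_u //= w_b.
  by case: (b).
have subJ b : J b \subset [set:: s] :\ x.
  by apply/subsetP=> z; rewrite !inE => /and3P[-> ->].
have leJ b : #|J b| <= (size s)./2.
  rewrite -(setIidPl (subset_trans (subJ b) (subsetDl _ _))).
  exact: independent_odd_cycle.
have cardJ : #|J true| + #|J false| = (size s).-1.
  have card_sx : #|[set:: s] :\ x| = (size s).-1.
    have := cardsD1 x [set:: s]; rewrite inE xs cardsE (card_uniqP s_uniq).
    by move->.
  rewrite -card_sx -(cardsID [set z | odd (index z t)] ([set:: s] :\ x)).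
  by congr (_ + _); apply: eq_card => z; rewrite !inE;
    case: (z \in s) (z == x) (odd _) => [] [] [].
exists (J (odd (index v t))); split=> //; first by rewrite inE vs vx eqxx.
(* The two halves have [(size s).-1] elements together and at most [(size s)./2] each; as [size s]
   is odd, both bounds are attained. *)
have := leJ true; have := leJ false; case: (odd (index v t)); lia.
Qed.

End IndependentSets.

(** * The maximum independent sets and their union *)

Section Corona.

Variables (T : finType) (e : rel T).
Hypotheses (e_sym : symmetric e) (e_irr : irreflexive e).
Variables (s s' : seq T) (x y : T) (A B : {set T}).
Hypotheses (s_odd : odd_cycle_seq e s) (s'_odd : odd_cycle_seq e s').
Hypothesis disj_s : forall z, z \in s -> z \notin s'.
Hypotheses (xs : x \in s) (ys' : y \in s').
Hypothesis nbr_s : {in s, forall u, u != x -> forall w, e u w ->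
  w = next s u \/ u = next s w}.
Hypothesis nbr_s' : {in s', forall u, u != y -> forall w, e u w ->
  w = next s' u \/ u = next s' w}.
Hypothesis bicrit : two_bicritical e.
Hypothesis bip_AB :
  bipartition e (~: (([set:: s] :|: [set:: s']) :\: [set x; y])) A B.
Hypotheses (xA : x \in A) (yA : y \in A).
Hypotheses (x_nbr : exists2 z, e x z & z \in B) (y_nbr : exists2 z, e y z & z \in B).

Implicit Types (u v w z : T) (I J : {set T}).

Lemma mem_AB z :
  (z \in A) || (z \in B) = [|| z == x, z == y | (z \notin s) && (z \notin s')].
Proof.
have [UAB _ _ _] := bip_AB; rewrite -in_setU UAB !inE negb_and !negbK negb_or.
by case: eqP; case: eqP.
Qed.

Lemma notin_B z : z \in A -> z \notin B.
Proof. by have [_ disjAB _ _] := bip_AB => /(disjointFr disjAB)->. Qed.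

Lemma B_notin z : z \in B -> (z \notin s) && (z \notin s').
Proof.
move=> zB; have := mem_AB z; rewrite zB orbT => /esym/or3P[/eqP eq_z|/eqP eq_z|//].
  by have := notin_B xA; rewrite -eq_z zB.
by have := notin_B yA; rewrite -eq_z zB.
Qed.

Lemma A_notin z : z \in A :\: [set x; y] -> (z \notin s) && (z \notin s').
Proof.
rewrite !inE negb_or => /andP[/andP[zx zy] zA].
by have := mem_AB z; rewrite zA (negPf zx) (negPf zy).
Qed.

(** The four pieces partition the vertices: [x] and [y] are counted with the cycles, and the rest of
    [A] and all of [B] lie off them. *)
Lemma cardI_split I :
  #|I| = #|I :&: [set:: s]| + #|I :&: [set:: s']|
         + #|I :&: (A :\: [set x; y])| + #|I :&: B|.
Proof.
rewrite -(cardsID [set:: s] I) -(cardsID [set:: s'] (I :\: _)).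
rewrite -(cardsID B (I :\: _ :\: _)) -!addnA; congr (_ + _); congr addn.
  apply: eq_card => z; rewrite !inE.
  by case: (boolP (z \in s)) => [/disj_s/negPf->|]; rewrite ?andbF.
rewrite addnC; congr addn; apply: eq_card => z; rewrite !inE.
  have := mem_AB z; have [zA|zA] := boolP (z \in A).
    rewrite (negPf (notin_B zA)) /= => /esym.
    have [->|zx] := eqVneq z x; first by rewrite xs !andbF.
    have [->|zy] := eqVneq z y; first by rewrite ys' !andbF.
    by rewrite /= andbT => /andP[-> ->].
  have [zB|zB] /= := boolP (z \in B); rewrite !andbF //.
  by move/esym/negbT; rewrite !negb_or negb_and !negbK => /and3P[_ _ /orP[]->]; rewrite ?andbF.
by case: (boolP (z \in B)) => [/B_notin/andP[-> ->]|]; rewrite ?andbF.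
Qed.

(** A neighbour on a cycle, other than [x] and [y], would have all its neighbours on that cycle,
    whereas [u] lies on neither. The lemma also serves to establish which side contains [x] and
    [y]. *)
Lemma nbr_A u w : u \in A -> u \notin [set x; y] -> e u w -> w \in B.
Proof.
move=> uA uxy euw; have /A_notin/andP[us us'] : u \in A :\: [set x; y] by rewrite inE uxy.
have [_ _ indA _] := bip_AB; have wA := independent_edge indA uA euw.
have := mem_AB w; rewrite (negPf wA) /= => ->; rewrite e_sym in euw.
apply: contraT; rewrite !negb_or negb_and !negbK => /and3P[wx wy /orP[ws|ws']].
  have [def_u|def_w] := nbr_s ws wx euw.
    by rewrite def_u mem_next ws in us.
  by rewrite def_w mem_next (negPf us) in ws.
have [def_u|def_w] := nbr_s' ws' wy euw.
  by rewrite def_u mem_next ws' in us'.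
by rewrite def_w mem_next (negPf us') in ws'.
Qed.

(** The boolean, read as 0 or 1, records that the inequality is strict when [I] meets [A]. If [I]
    meets [A] outside [[set x; y]], 2-bicriticality gives strictness; if only in [x] or [y], a
    neighbour of that vertex in [B] is missing from [I]. *)
Lemma card_AB_bound I : independent e I ->
  #|I :&: (A :\: [set x; y])| + #|I :&: B| + (I :&: A != set0) <= #|B|.
Proof.
move=> indI; have cardB := cardsID I B; rewrite setIC in cardB.
have [S0|S0] := eqVneq (I :&: (A :\: [set x; y])) set0; last first.
  have indS : independent e (I :&: (A :\: [set x; y])).
    by apply: independentS indI; apply: subsetIl.
  have lt_S : #|I :&: (A :\: [set x; y])| < #|B :\: I|.
    apply: leq_trans (bicrit S0 indS) (subset_leq_card _).
    apply/bigcupsP=> u /setIP[uI /setDP[uA uxy]]; apply/subsetP=> w; rewrite inE => euw.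
    by rewrite inE (nbr_A uA uxy euw) (independent_edge indI uI euw).
  by case: (_ != _); lia.
rewrite S0 cards0 add0n; have [_|/set0Pn[u /setIP[uI uA]]] := eqVneq (I :&: A) set0.
  by rewrite addn0 subset_leq_card // subsetIr.
have uxy : u \in [set x; y].
  by apply: contraT => uxy; have /setP/(_ u) := S0; rewrite 2!inE uI !inE uA -in_set2 uxy.
have [z euz zB] : exists2 z, e u z & z \in B by case/set2P: uxy => ->.
rewrite addn1 -cardB -[X in X < _]addn0 ltn_add2l card_gt0; apply/set0Pn; exists z.
by rewrite inE zB (independent_edge indI uI euz).
Qed.

Lemma independent_bound I : independent e I ->
  #|I| + (I :&: A != set0) <= (size s)./2 + (size s')./2 + #|B|.
Proof.
move=> indI; rewrite cardI_split.
have := independent_odd_cycle s_odd indI; have := independent_odd_cycle s'_odd indI.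
have := card_AB_bound indI; lia.
Qed.

(** Since [J] avoids [x] and [J'] avoids [y], their neighbours stay on the respective cycles, which
    are disjoint from each other and from [B]. *)
Lemma half_cyclesU J J' :
    J \subset [set:: s] :\ x -> independent e J -> #|J| = (size s)./2 ->
    J' \subset [set:: s'] :\ y -> independent e J' -> #|J'| = (size s')./2 ->
  independent e (J :|: J' :|: B)
    /\ #|J :|: J' :|: B| = (size s)./2 + (size s')./2 + #|B|.
Proof.
move=> /subsetP sJ indJ cardJ /subsetP sJ' indJ' cardJ'.
have [_ _ _ indB] := bip_AB.
have Js u : u \in J -> u \in s /\ u != x by move/sJ; rewrite !inE => /andP[].
have J's u : u \in J' -> u \in s' /\ u != y by move/sJ'; rewrite !inE => /andP[].
have nbrJ u w : u \in J -> e u w -> w \in s.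
  case/Js=> us ux /(nbr_s us ux)[->|def_u]; first by rewrite mem_next.
  by rewrite def_u mem_next in us.
have nbrJ' u w : u \in J' -> e u w -> w \in s'.
  case/J's=> us uy /(nbr_s' us uy)[->|def_u]; first by rewrite mem_next.
  by rewrite def_u mem_next in us.
split.
  apply: independentU => //; first apply: independentU => //.
    move=> u w uJ /J's[ws' _]; apply/negP => /(nbrJ _ _ uJ)/disj_s.
    by rewrite ws'.
  move=> u w /setUP[uJ|uJ'] /B_notin/andP[ws ws'].
    by apply: contraNN ws => /(nbrJ _ _ uJ).
  by apply: contraNN ws' => /(nbrJ' _ _ uJ').
rewrite !cardsU cardJ cardJ'.
have -> : J :&: J' = set0.
  apply/setP=> u; rewrite !inE; apply/andP=> -[/Js[us _] /J's[us' _]].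
  by have := disj_s us; rewrite us'.
have -> : (J :|: J') :&: B = set0.
  apply/setP=> u; rewrite !inE; apply/andP=> -[uJJ' /B_notin/andP[us us']].
  by case/orP: uJJ' => [/Js|/J's] []; rewrite ?(negPf us) ?(negPf us').
by rewrite !cards0 !subn0.
Qed.

Lemma corona_eq : corona e = ~: A.
Proof.
have [s_gt2 s_uniq] : 2 < size s /\ uniq s by case: s_odd.
have half v (vs : v \in s) vx := half_cycle_independent s_odd xs nbr_s vs vx.
have half' v (vs' : v \in s') vy := half_cycle_independent s'_odd ys' nbr_s' vs' vy.
have next_neq r z : odd_cycle_seq e r -> z \in r -> next r z != z.
  case=> _ _ _ /next_cycle-next_r /next_r; apply: contraTneq => ->.
  by rewrite e_irr.
(* Some half of each cycle is fixed; [next s x] and [next s' y] are just vertices distinct from [x]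
   and [y]. *)
have [|J [sJ _ indJ cardJ]] := half (next s x) _ (next_neq _ _ s_odd xs).
  by rewrite mem_next.
have [|J' [sJ' _ indJ' cardJ']] := half' (next s' y) _ (next_neq _ _ s'_odd ys').
  by rewrite mem_next.
have [indJJ' cardJJ'] := half_cyclesU sJ indJ cardJ sJ' indJ' cardJ'.
have maxU I : independent e I ->
    #|I| = (size s)./2 + (size s')./2 + #|B| -> max_independent e I.
  move=> indI cardI; rewrite /max_independent indI; apply/forall_inP=> U indU.
  by rewrite cardI; apply: leq_trans (leq_addr _ _) (independent_bound indU).
apply/setP=> v; rewrite inE; apply/bigcupP/idP => [[I maxI vI]|vA].
  (* A maximum set is at least as large as [J :|: J' :|: B], which already attains the bound, so
     there is no room for the extra 1 due to meeting [A]. *)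
  apply/negP => vA; have /andP[indI /forall_inP/(_ _ indJJ')] := maxI.
  have := independent_bound indI; rewrite cardJJ'.
  have -> : I :&: A != set0 by apply/set0Pn; exists v; rewrite inE vI.
  by rewrite addn1 ltnNge => /negP.
have := mem_AB v; rewrite (negPf vA) /=.
have [vB _|vB] := boolP (v \in B).
  by exists (J :|: J' :|: B); [apply: maxU | rewrite !inE vB orbT].
move/esym/negbT; rewrite !negb_or negb_and !negbK => /and3P[vx vy /orP[vs|vs']].
  have [J1 [sJ1 vJ1 indJ1 cardJ1]] := half v vs vx.
  have [ind card] := half_cyclesU sJ1 indJ1 cardJ1 sJ' indJ' cardJ'.
  by exists (J1 :|: J' :|: B); [apply: maxU | rewrite !inE vJ1].
have [J1 [sJ1 vJ1 indJ1 cardJ1]] := half' v vs' vy.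
have [ind card] := half_cyclesU sJ indJ cardJ sJ1 indJ1 cardJ1.
by exists (J :|: J1 :|: B); [apply: maxU | rewrite !inE vJ1 orbT].
Qed.

End Corona.

(** * Even-linked graphs: locating [X], [x] and [y], and counting *)

Theorem theorem4p6 (T : finType) (e : rel T)
  (e_sym : symmetric e) (e_irr : irreflexive e)
  (n : nat) (order_G : #|T| = n)
  (G_even_linked : even_linked e)
  (C C' : subgraph T) (odd_cycles_G : exactly_two_odd_cycles e C C')
  (X : {set T})
  (X_def : X = [set v in sg_verts C :|: sg_verts C' | degree e v == 2])
  (A B : {set T}) (bip_AB : bipartition e (~: X) A B) (card_AB : #|A| = #|B| + 1)
  (p : nat) (G_ : nat -> subgraph T) (D : subgraph T)
  (x : T) (q : seq T) (y : T)
  (decomp : even_linked_decomposition e p G_ D x q y) :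
  [/\ corona e = (sg_verts C :|: sg_verts C' :|: B) :\: [set x; y],
      (sg_verts C :|: sg_verts C' :|: B) :\: [set x; y] = ~: A
    & (#|corona e|%:R = (n%:R + #|sg_verts C :|: sg_verts C'|%:R - 3%:R) / 2%:R
        :> rat)%R].

Proof.
have [_ bicrit _ _] := G_even_linked.
have [_ only_CC'] := odd_cycles_G.
case: decomp => G0_odd [[D_odd disj_D /andP[q_path _] [xG0 yD] q_out] _] q_even _ _.
have [s [s_gt2 s_odd s_uniq s_cyc def_G0]] := G0_odd.
have [s' [s'_gt2 s'_odd s'_uniq s'_cyc def_D]] := D_odd.
have s_oddc : odd_cycle_seq e s by split.
have s'_oddc : odd_cycle_seq e s' by split.
rewrite def_G0 def_D /= in disj_D xG0 yD q_out.
have xs : x \in s by rewrite inE in xG0.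
have ys' : y \in s' by rewrite inE in yD.
have disj_s z : z \in s -> z \notin s'.
  by move=> zs; have := disjointFl disj_D (x := z); rewrite !inE zs => /(_ isT)->.
have disj_s' z : z \in s' -> z \notin s by apply: contraL => /disj_s.
(* [C] and [C'] are [G_ 0] and [D] in one order or the other; only the union of their vertex sets
   matters from here on. *)
have UE : sg_verts C :|: sg_verts C' = [set:: s] :|: [set:: s'] /\
    (forall c, odd_cycle_seq e c -> [set:: c] = [set:: s] \/ [set:: c] = [set:: s']).
  have neq_G0D : G_ 0 <> D.
    rewrite def_G0 def_D => /(congr1 (@sg_verts T))/setP/(_ x) /=.
    by rewrite !inE xs (negPf (disj_s _ xs)).
  have [[CG0 CD]|[CG0 CD]] : C = G_ 0 /\ C' = D \/ C = D /\ C' = G_ 0.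
    by case/only_CC': G0_odd neq_G0D => ->; case/only_CC': D_odd => ->; auto.
  - split=> [|c [? ? ? ?]]; first by rewrite CG0 CD def_G0 def_D.
    have /only_CC'[] : odd_cycle e (cycle_graph c) by exists c.
      by rewrite CG0 def_G0 => /(congr1 (@sg_verts T)); left.
    by rewrite CD def_D => /(congr1 (@sg_verts T)); right.
  split=> [|c [? ? ? ?]]; first by rewrite CG0 CD def_G0 def_D setUC.
  have /only_CC'[] : odd_cycle e (cycle_graph c) by exists c.
    by rewrite CG0 def_D => /(congr1 (@sg_verts T)); right.
  by rewrite CD def_G0 => /(congr1 (@sg_verts T)); left.
have [{}UE only_s] := UE; rewrite {}UE in X_def *.
have only_s' c : odd_cycle_seq e c -> [set:: c] = [set:: s'] \/ [set:: c] = [set:: s].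
  by case/only_s; auto.
have q_outs v : v \in q -> (v \notin s) && (v \notin s').
  by move/(allP q_out); rewrite !inE negb_or.
have X_def' : X = [set v in [set:: s'] :|: [set:: s] | degree e v == 2] by rewrite setUC.
(* The reversed path lets the results about [s] and [x] be applied to [s'] and [y]. *)
have rq_path := path_rev_sym e_sym q_path.
have rq_odd : odd (size (rev q)) by rewrite size_rev; move: q_even; rewrite /= negbK.
have q_odd : odd (size q) by rewrite size_rev in rq_odd.
have nbr_s : {in s, forall u, u != x -> forall w, e u w -> w = next s u \/ u = next s w}.
  (* The path has even length, so [q] has odd size and a first vertex [z]. *)
  case: q q_path q_outs q_odd {q_out q_even rq_path rq_odd} => // z q q_path q_outs _.
  apply: (linked_cycle_nbrs e_sym e_irr s_oddc s'_oddc
    disj_s only_s bicrit X_def bip_AB xs ys' q_path).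
  by move=> v /q_outs/andP[].
have nbr_s' : {in s', forall u, u != y -> forall w, e u w -> w = next s' u \/ u = next s' w}.
  have rq_outs v : v \in rev q -> v \notin s' by rewrite mem_rev => /q_outs/andP[].
  case: (rev q) rq_path rq_outs rq_odd => // z rq rq_path rq_outs _.
  exact: (linked_cycle_nbrs e_sym e_irr s'_oddc s_oddc
    disj_s' only_s' bicrit X_def' bip_AB ys' xs rq_path).
have [zx exzx zxq] : exists2 z, e x z & z \in q.
  case: q q_path q_odd {q_out q_even rq_path rq_odd q_outs} => //= z q /andP[exz _] _.
  by exists z; rewrite ?mem_head.
have [zy eyzy zyq] : exists2 z, e y z & z \in q.
  have : {subset rev q <= q} by move=> z; rewrite mem_rev.
  case: (rev q) rq_path rq_odd => //= z rq /andP[eyz _] _ sub.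
  by exists z; rewrite ?sub ?mem_head.
have /andP[zxs zxs'] := q_outs _ zxq; have /andP[zys zys'] := q_outs _ zyq.
have {}X_def : X = ([set:: s] :|: [set:: s']) :\: [set x; y].
  rewrite X_def; apply/setP=> v; rewrite !inE negb_or andbC.
  have [vs|vs] := boolP (v \in s).
    have -> /= : v != y by apply: contraNneq (disj_s _ vs) => ->.
    rewrite !andbT; have [->|vx] := eqVneq v x.
      by rewrite gtn_eqF // (degree_gt2 e_sym s_oddc xs zxs exzx).
    by rewrite (degree_cycle_eq2 e_sym s_oddc vs (nbr_s v vs vx)).
  have [vs'|] := boolP (v \in s'); last by rewrite !andbF.
  have -> /= : v != x by apply: contraNneq vs => ->.
  rewrite !andbT; have [->|vy] := eqVneq v y.
    by rewrite gtn_eqF // (degree_gt2 e_sym s'_oddc ys' zys' eyzy).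
  by rewrite (degree_cycle_eq2 e_sym s'_oddc vs' (nbr_s' v vs' vy)).
rewrite X_def in bip_AB.
have memAB := mem_AB bip_AB; have notB := notin_B bip_AB.
have eq_xy : (x \in A) = (y \in A).
  apply: even_path_side bip_AB q_path q_odd _ => v.
  rewrite -rcons_cons mem_rcons !inE => /or3P[/eqP->|/eqP->|/q_outs/andP[vs vs']].
  - by rewrite eqxx orbT.
  - by rewrite eqxx.
  - by rewrite (negPf vs) (negPf vs') andbF.
have [_ _ indA _] := bip_AB.
have xA : x \in A.
  apply: contraT => xA; have yA : y \notin A by rewrite -eq_xy.
  have A0 : A != set0 by rewrite -card_gt0 card_AB addn1.
  (* If neither [x] nor [y] lay in [A], then [N(A)] would be contained in [B], which is smaller than
     [A]. *)
  have := leq_trans (bicrit A A0 indA) (subset_leq_card (_ : nbhs_set e A \subset B)).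
  rewrite card_AB addn1 ltnNge leqnSn; apply.
  apply/bigcupsP=> u uA; apply/subsetP=> w; rewrite inE.
  apply: (nbr_A e_sym nbr_s nbr_s' bip_AB uA); rewrite !inE.
  by apply/norP; split; [apply: contraNneq xA => <- | apply: contraNneq yA => <-].
have yA : y \in A by rewrite -eq_xy.
have nbr_AB u z : u \in A -> e u z -> z \in q -> z \in B.
  move=> uA euz /q_outs zq; have := memAB z.
  by rewrite zq (negPf (independent_edge indA uA euz)) /= => ->; rewrite !orbT.
have coronaE : corona e = ~: A.
  apply: (corona_eq e_sym e_irr s_oddc s'_oddc disj_s xs ys'
    nbr_s nbr_s' bicrit bip_AB xA yA).
    by exists zx => //; apply: nbr_AB xA _ _.
  by exists zy => //; apply: nbr_AB yA _ _.
have UBE : ([set:: s] :|: [set:: s'] :|: B) :\: [set x; y] = ~: A.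
  apply/setP=> z; have := memAB z; rewrite !inE negb_or.
  have [->|zx'] := eqVneq z x; first by rewrite xA.
  have [->|zy'] := eqVneq z y; first by rewrite yA.
  have [/notB/negPf->|zA] /= := boolP (z \in A).
    by move/esym/andP=> [/negPf-> /negPf->].
  by move->; case: (z \in s); case: (z \in s').
split; rewrite ?UBE // coronaE.
(* The count is first stated over the naturals without subtraction. It combines
   [#|A| + #|B| = n - #|X|] with [#|A| = #|B| + 1], where [X] is the union of the cycles less two
   vertices. *)
have eq_card : 2 * #|~: A| + 3 = n + #|[set:: s] :|: [set:: s']|.
  have [UAB disjAB _ _] := bip_AB; rewrite -X_def in UAB.
  have cardUAB : #|A| + #|B| = #|~: X|.
    rewrite -UAB cardsU (_ : A :&: B = set0) ?cards0 ?subn0 //.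
    by apply/eqP; rewrite setI_eq0.
  have cardX : #|X| + 2 = #|[set:: s] :|: [set:: s']|.
    have xy : x != y by apply: contraNneq (disj_s _ xs) => ->.
    rewrite X_def -(cardsID [set x; y] ([set:: s] :|: _)) addnC; congr (_ + _).
    rewrite (setIidPr _) ?cards2 ?xy //; apply/subsetP=> v.
    by rewrite !inE => /orP[]/eqP->; rewrite ?xs ?ys' ?orbT.
  move: cardUAB cardX (cardsC A) (cardsC X) card_AB; rewrite order_G.
  clear; move: #|A| #|B| #|X| #|~: A| #|~: X| #|_ :|: _|; lia.
have := congr1 (fun k => k%:R : rat)%R eq_card; rewrite /= natrD natrM natrD.
clear; lra.
Qed.
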